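(* Let $n,k,\ell$ be positive integers, and let $\Gamma=\mathrm{Cay}(\mathbb{Z}_n,\{x^k,x^{-k},x^\ell,x^{-\ell}\})$ be a connected circulant quartic graph. Then: (i) If $k$ is odd and $\ell\equiv0\pmod 4$, or $\ell$ is odd and $k\equiv0\pmod 4$, then $\Gamma$ contains a $(3,1)$-regular set if and only if $n$ is a multiple of $4$. (ii) If $k$ is odd and $\ell\equiv2\pmod 4$, or $\ell$ is odd and $k\equiv2\pmod 4$, then $\Gamma$ contains no $(3,1)$-regular set. (iii) If $k\equiv1\pmod 2$ and $\ell\equiv1\pmod 2$, then $\Gamma$ contains no $(3,1)$-regular set.
   Context: $\mathbb{Z}_n=\langle x\rangle$ denotes the cyclic group of order $n$, written multiplicatively. For a finite group $G$ with identity $e$ and an inverse-closed subset $S\subseteq G\setminus\{e\}$, the Cayley graph $\mathrm{Cay}(G,S)$ is the simple graph with vertex set $G$ in which $y$ and $z$ are adjacent if and only if $y^{-1}z\in S$. A circulant quartic graph is a graph $\mathrm{Cay}(\mathbb{Z}_n,\{x^k,x^{-k},x^\ell,x^{-\ell}\})$ where $x^k,x^{-k},x^\ell,x^{-\ell}$ are four distinct non-identity elements. For a graph $\Gamma$ and nonnegative integers $a,b$, a nonempty proper subset $C$ of $V(\Gamma)$ is an $(a,b)$-regular set of $\Gamma$ if every vertex in $C$ has exactly $a$ neighbours in $C$ and every vertex in $V(\Gamma)\setminus C$ has exactly $b$ neighbours in $C$. *)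

(* Defs.v *)
From HB Require Import structures.
From mathcomp Require Import all_boot all_fingroup.
Set Implicit Arguments.
Unset Strict Implicit.
Unset Printing Implicit Defensive.

(* A simple graph on a finite type T is given by its adjacency
   relation, a symmetric and irreflexive [rel T]. *)

Definition connected_graph (T : finType) (e : rel T) : Prop :=
  forall u v : T, connect e u v.

Definition regular_set (T : finType) (e : rel T) (a b : nat) (C : {set T}) :
  Prop :=
  [/\ C != set0,
      C \proper [set: T],
      forall v, v \in C -> #|[set w in C | e v w]| = a
    & forall v, v \notin C -> #|[set w in C | e v w]| = b].

(* Defined for every S, this is a simple graph when S is inverse-closed
   and does not contain the identity, see [cay_sym] and [cay_irr]. *)
Definition cay (gT : finGroupType) (S : {set gT}) : rel gT :=
  fun y z => (y^-1 * z)%g \in S.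

Lemma cay_sym (gT : finGroupType) (S : {set gT}) :
  (forall s, s \in S -> s^-1%g \in S) -> symmetric (cay S).
Proof.
move=> invS; suff sub y z : cay S y z -> cay S z y.
  by move=> y z; apply/idP/idP; apply: sub.
by move=> /invS; rewrite /cay invMg invgK.
Qed.

Lemma cay_irr (gT : finGroupType) (S : {set gT}) :
  1%g \notin S -> irreflexive (cay S).
Proof. by move=> /negbTE S1 y; rewrite /cay mulVg. Qed.

Definition circ_set (gT : finGroupType) (x : gT) (k l : nat) : {set gT} :=
  [set x ^+ k; x ^- k; x ^+ l; x ^- l]%g.

(* The condition that makes [cay (circ_set x k l)] a circulant quartic graph
   when x generates its ambient group. *)
Definition circ_quartic (gT : finGroupType) (x : gT) (k l : nat) : bool :=
  let s := [:: x ^+ k; x ^- k; x ^+ l; x ^- l]%g in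
  uniq s && (1%g \notin s).

Lemma circ_set_inv (gT : finGroupType) (x : gT) (k l : nat) (s : gT) :
  s \in circ_set x k l -> s^-1%g \in circ_set x k l.
Proof.
rewrite !inE -!orbA => /or4P[] /eqP ->; by rewrite ?invgK eqxx ?orbT.
Qed.

Lemma circ_quartic_simple (gT : finGroupType) (x : gT) (k l : nat) :
  circ_quartic x k l ->
  symmetric (cay (circ_set x k l)) /\ irreflexive (cay (circ_set x k l)).
Proof.
move=> /andP[_ s1]; split; first exact/cay_sym/circ_set_inv.
by apply: cay_irr; move: s1; rewrite !inE -!orbA.
Qed.

(* Main.v *)
Require Import Defs.
From mathcomp Require Import all_boot all_fingroup.
From mathcomp Require Import all_algebra cyclic zify ring.

(** Let [f v] say whether [x ^ v] lies in [C], for an integer [v]. Then [C] is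
    (3,1)-regular exactly when the number of [f]-neighbours of every [v],
      f (v + k) + f (v - k) + f (v + l) + f (v - l),
    equals [2 f v + 1] ([balanced]), and [f] has period [n]. Everything is
    deduced from this equation. The proof avoids the spectrum of the graph; its
    place is taken by two congruence arguments.

    Modulo 2. The operator on the left becomes a product of two differences,
    with steps [k + l] and [k - l], and the right-hand side becomes 1. So a
    first difference of [f] changes at each step, which cannot happen along a
    cycle of odd length. This excludes a period [2 m] with [m] odd unless [k]
    and [l] are both even ([balanced_odd_period]). Hence every period of [f] is
    a multiple of 4, which gives the forward direction of (i).

    Modulo a prime [p > 3]. Let [T] be the shift of [f] and [g = 2 f - 1]; the
    equation reads [Q(T) g = 0] with [Q(T) = T^k + T^-k + T^l + T^-l - 2].
    Modulo [p], [Q(T^p)] is [Q(T)^p], hence it kills [g] as well. The two sides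
    of the equation for [(p k, p l)] are thus congruent modulo [p], and they
    are too small to differ: [f] is balanced for [(p k, p l)]. So it is
    balanced for [(u k, u l)] whenever [u] is coprime to 6
    ([balanced_coprime6]). This replaces the Galois conjugation of the
    eigenvalue equation, and so the irreducibility of cyclotomic polynomials.

    If [4 q] is a period, take [u = 1 + 6 q]: then [u k] is [k + 2 q] or [k]
    modulo [4 q] according as [k] is odd or even. Comparing the equations for
    [(k, l)] and [(u k, u l)] shows that [2 q] is also a period when [k] is odd
    and [l] is odd or 2 modulo 4 ([balanced_halve]). As all periods are
    multiples of 4, infinite descent excludes these cases, which are (ii) and
    (iii).

    For the converse in (i), the powers of [x] with exponent 0 or 1 modulo 4
    form a regular set: a step by a multiple of 4 preserves membership, and of
    two opposite odd steps exactly one lands in the set. *)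

Set Implicit Arguments.
Unset Strict Implicit.
Unset Printing Implicit Defensive.
Import GRing.Theory.
Local Open Scope ring_scope.

(** * Balanced functions on the integers *)

Definition balanced (f : int -> bool) (k l : nat) : Prop :=
  forall v : int,
    (f (v + k)%R + f (v - k%:Z)%R + f (v + l)%R + f (v - l%:Z)%R =
     (f v).*2.+1)%N.

Definition periodic (T : Type) (f : int -> T) (n : nat) : Prop :=
  forall v : int, f (v + n) = f v.

Lemma periodic_mul (T : Type) (f : int -> T) (n m : nat) :
  periodic f n -> forall v : int, f (v + (m * n)%N) = f v.
Proof.
move=> fn; elim: m => [|m IHm] v; first by rewrite mul0n addr0.
have -> : v + (m.+1 * n)%N = v + n + (m * n)%N by lia.
by rewrite IHm fn.
Qed.

Lemma balancedC (f : int -> bool) (k l : nat) :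
  balanced f k l -> balanced f l k.
Proof. by move=> fb v; have := fb v; lia. Qed.

(** Over the field with two elements, [T^k + T^-k + T^l + T^-l] is a monomial
    times [(1 + T^(k + l)) (1 + T^(k - l))], where [T] is the shift; [h] is the
    image of [f] under the first factor, and it changes at each step [k - l].
    After [m] steps it has changed. If [k - l] is even, [m] steps amount to a
    period: contradiction. If it is odd, they amount to [m], and so
    [(1 + T^m) (1 + T^(k + l)) f = 1]. Now [p], the image of [f] under
    [1 + T^m], changes at each step [k + l]; again [m] steps amount to [m], but
    a translation by [m] only swaps the two terms of [p]. *)
Lemma balanced_odd_period (f : int -> bool) (k l m : nat) :
    odd m -> odd k || odd l -> periodic f m.*2 -> balanced f k l -> False.
Proof.
wlog k_odd : k l / odd k => [W|] m_odd kl_odd fm fb.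
  case/orP: (kl_odd) => [k_odd | l_odd]; first exact: (W k l).
  by apply: (W l k); rewrite ?l_odd //; apply: balancedC.
pose h (v : int) := f (v + (k + l)%N) (+) f v.
have hkl (v : int) : h (v + k) = ~~ h (v + l).
  have := fb (v + (k + l)%N); rewrite /h.
  have -> : v + (k + l)%N + k = v + k + (k + l)%N by lia.
  have -> : v + (k + l)%N - k%:Z = v + l by lia.
  have -> : v + (k + l)%N + l = v + l + (k + l)%N by lia.
  have -> : v + (k + l)%N - l%:Z = v + k by lia.
  by do 5!case: (f _).
have hmkl (v : int) j : h (v + (j * k)%N) = odd j (+) h (v + (j * l)%N).
  elim: j v => [|j IHj] v; first by rewrite !mul0n.
  have -> : v + (j.+1 * k)%N = v + k + (j * k)%N by lia.
  rewrite IHj; have -> : v + k + (j * l)%N = v + (j * l)%N + k by lia.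
  rewrite hkl; have -> : v + (j * l)%N + l = v + (j.+1 * l)%N by lia.
  by rewrite addbN -addNb.
have f_odd (v : int) a : odd a -> f (v + (m * a)%N) = f (v + m).
  move=> a_odd; have -> : v + (m * a)%N = v + m + (a./2 * m.*2)%N by nia.
  exact: periodic_mul.
have f_even (v : int) a : ~~ odd a -> f (v + (m * a)%N) = f v.
  move=> a_even; have -> : v + (m * a)%N = v + (a./2 * m.*2)%N by nia.
  exact: periodic_mul.
have h_odd (v : int) a : odd a -> h (v + (m * a)%N) = h (v + m).
  by move=> ao; rewrite /h addrAC !f_odd // addrAC.
have h_even (v : int) a : ~~ odd a -> h (v + (m * a)%N) = h v.
  by move=> ao; rewrite /h addrAC !f_even.
have := hmkl 0 m; rewrite m_odd h_odd //.
have [l_odd | l_even] := boolP (odd l).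
  by rewrite h_odd //; case: (h _).
rewrite h_even // => _.
have hm (v : int) : h (v + m) = ~~ h v.
  by have := hmkl v m; rewrite m_odd h_odd // h_even.
pose p (v : int) := f (v + m) (+) f v.
have pkl (v : int) : p (v + (k + l)%N) = ~~ p v.
  have := hm v; rewrite /p /h.
  have -> : v + m + (k + l)%N = v + (k + l)%N + m by lia.
  by do 4!case: (f _).
have pj (v : int) j : p (v + (j * (k + l))%N) = odd j (+) p v.
  elim: j => [|j IHj]; first by rewrite mul0n addr0.
  have -> : v + (j.+1 * (k + l))%N = v + (j * (k + l))%N + (k + l)%N by lia.
  by rewrite pkl IHj -addNb.
have klo : odd (k + l) by rewrite oddD k_odd (negbTE l_even).
have := pj 0 m; rewrite m_odd /p addrAC !f_odd //.
have -> : 0 + m%:Z + m%:Z = 0 + m.*2%:Z by lia.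
by rewrite fm; do 2!case: (f _).
Qed.

(** * Multiplying the steps by an integer coprime to 6 *)

(** The action on functions on the integers of a polynomial in the shift
    operator [v |-> v + 1]. *)
Definition shift_act {R : nzRingType} (G : int -> R) (q : {poly R})
    (v : int) : R :=
  \sum_(i < size q) q`_i * G (v + i).

Section ShiftAct.
Variables (R : comNzRingType) (G : int -> R).
Implicit Types (q r : {poly R}) (v : int).

Lemma shift_act_wide q v m : (size q <= m)%N ->
  shift_act G q v = \sum_(i < m) q`_i * G (v + i).
Proof.
move=> qm; rewrite /shift_act (big_ord_widen _ (fun i => q`_i * G (v + i)) qm).
rewrite big_mkcond; apply: eq_bigr => i _.
by case: ltnP => // qi; rewrite nth_default // mul0r.
Qed.

Lemma shift_actD q r v :
  shift_act G (q + r) v = shift_act G q v + shift_act G r v.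
Proof.
pose m := maxn (size q) (size r).
rewrite (@shift_act_wide _ _ m) ?size_polyD //.
rewrite (@shift_act_wide q _ m) ?leq_maxl //.
rewrite (@shift_act_wide r _ m) ?leq_maxr //.
by rewrite -big_split /=; apply: eq_bigr => i _; rewrite coefD mulrDl.
Qed.

Lemma shift_actMC q (c : R) v :
  shift_act G (q * c%:P) v = c * shift_act G q v.
Proof.
rewrite (@shift_act_wide _ _ (size q)) ?mulr_sumr; last first.
  by rewrite mulrC mul_polyC size_scale_leq.
by apply: eq_bigr => i _; rewrite coefMC mulrCA mulrA.
Qed.

Lemma shift_actN q v : shift_act G (- q) v = - shift_act G q v.
Proof. by rewrite -[- q]mulrN1 -polyC1 -polyCN shift_actMC mulN1r. Qed.

Lemma shift_actMX q v : shift_act G (q * 'X) v = shift_act G q (v + 1).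
Proof.
rewrite (@shift_act_wide _ _ (size q).+1); last first.
  by have [->|q0] := eqVneq q 0; rewrite ?mul0r ?size_poly0 // size_mulX.
rewrite big_ord_recl coefMX mul0r add0r; apply: eq_bigr => i _.
by rewrite lift0 coefMX /= intS addrA.
Qed.

Lemma shift_actXn (m : nat) v : shift_act G 'X^m v = G (v + m).
Proof.
elim: m v => [|m IHm] v; last by rewrite exprSr shift_actMX IHm; congr G; lia.
by rewrite expr0 /shift_act size_poly1 big_ord1 coef1 mul1r.
Qed.

Lemma shift_act_ann q r :
  (forall v, shift_act G q v = 0) -> forall v, shift_act G (q * r) v = 0.
Proof.
move=> q0; elim/poly_ind: r => [|r c IHr] v.
  by rewrite mulr0 /shift_act size_poly0 big_ord0.
by rewrite mulrDr shift_actD mulrA shift_actMX IHr shift_actMC q0 mulr0 addr0.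
Qed.

End ShiftAct.

(** [Q a] is the polynomial of the equation for [(a k, a l)], multiplied by a
    power of ['X] to clear negative exponents, and [Q p = Q 1 ^+ p] by
    Frobenius. Its action on the function [2 f - 1], for which the equation is
    homogeneous, is twice the difference of the two sides. These sides are at
    most 4 and at most 3, so that they agree once they agree modulo [p > 4]. *)
Lemma balanced_prime (f : int -> bool) (k l p : nat) :
  prime p -> (3 < p)%N -> balanced f k l -> balanced f (p * k) (p * l).
Proof.
move=> p_pr p3 fb.
pose G (v : int) : 'F_p := (f v).*2%:R - 1.
pose Q (a : nat) : {poly 'F_p} :=
  'X^(a * (k + l) + a * k) + 'X^(a * l) + 'X^(a * (k + l) + a * l) + 'X^(a * k)
  - 'X^(a * (k + l)) - 'X^(a * (k + l)).
have QG (a : nat) (v : int) :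
    shift_act G (Q a) (v - (a * (k + l))%N%:Z) =
    (f (v + (a * k)%N)%R + f (v - (a * k)%N%:Z)%R + f (v + (a * l)%N)%R +
      f (v - (a * l)%N%:Z)%R)%N.*2%:R - (f v).*2.+1.*2%:R.
  rewrite /Q !shift_actD !shift_actN !shift_actXn.
  rewrite !mulnDr; set ak := (a * k)%N; set al := (a * l)%N.
  have -> : v - (ak + al)%N%:Z + (ak + al + ak)%N = v + ak by lia.
  have -> : v - (ak + al)%N%:Z + (ak + al + al)%N = v + al by lia.
  have -> : v - (ak + al)%N%:Z + (ak + al)%N = v by lia.
  have -> : v - (ak + al)%N%:Z + al = v - ak%:Z by lia.
  have -> : v - (ak + al)%N%:Z + ak = v - al%:Z by lia.
  by rewrite /G -!addnn; ring.
have Q1 v : shift_act G (Q 1%N) v = 0.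
  have -> : v = v + (k + l)%N - (1 * (k + l))%N%:Z by lia.
  by rewrite QG !mul1n fb subrr.
have p_char : p \in [pchar {poly 'F_p}] by rewrite pchar_poly pchar_Fp.
have Qp : Q p = Q 1%N ^+ p.
  rewrite -(pFrobenius_autE p_char) /Q !rmorphB !rmorphD /= !pFrobenius_autE.
  by rewrite -!exprM !mul1n ![(_ * p)%N]mulnC !mulnDr.
have Qp0 v : shift_act G (Q p) v = 0.
  have -> : Q p = Q 1%N * Q 1%N ^+ p.-1 by rewrite Qp -exprS (ltn_predK p3).
  exact: shift_act_ann.
have two_neq0 : (2%:R : 'F_p) != 0.
  apply/eqP => /(congr1 (@nat_of_ord _)); rewrite val_Fp_nat // modn_small //.
  exact: ltnW.
move=> v; have /eqP := QG p v; rewrite Qp0 eq_sym subr_eq0 -!muln2 !natrM.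
move=> /eqP/(mulIf two_neq0)/(congr1 (@nat_of_ord _)); rewrite !val_Fp_nat //.
have p4 : p != 4 by apply: contraTneq p_pr => ->.
rewrite !modn_small //; last by do 4!case: (f _); lia.
by case: (f v); lia.
Qed.

Lemma coprime6_ind (P : nat -> Prop) :
    P 1%N -> (forall p u, prime p -> (3 < p)%N -> P u -> P (p * u)%N) ->
  forall u, coprime u 6 -> P u.
Proof.
move=> P1 PM u; have [m] := ubnP u; elim: m u => // m IHm u um u6.
have [u1 | u1] := leqP u 1.
  by case: u u1 u6 {um} => [|[|]].
have p_pr := pdiv_prime u1; have /dvdnP[w uE] := pdiv_dvd u.
have /andP[w6 p6] : coprime w 6 && coprime (pdiv u) 6 by rewrite -coprimeMl -uE.
have p3 : (3 < pdiv u)%N.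
  by move: (pdiv u) p_pr p6 => [|[|[|[|]]]].
rewrite uE mulnC; apply: PM => //; apply: IHm => //.
by rewrite uE in um; nia.
Qed.

Lemma balanced_coprime6 (f : int -> bool) (k l u : nat) :
  coprime u 6 -> balanced f k l -> balanced f (u * k) (u * l).
Proof.
move=> u6 fb; elim/coprime6_ind: u / u6 => [|p u p_pr p3 IH].
  by rewrite !mul1n.
by rewrite -!mulnA; apply: balanced_prime.
Qed.

(** * Descent on the period *)

(** Multiplication by [u] moves [k] by half the period [4 q]. If it also moves
    [l], the equation for [(u k, u l)] at [v] is the one for [(k, l)] at
    [v + 2 q], except that its right-hand side involves [f v]. If it fixes [l],
    then [G v = f (v + 2 q) - f v] satisfies [G (v + l) + G (v - l) = 2 G v].
    It is an arithmetic progression along multiples of [l], and being periodic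
    it is invariant under [l]. Since [q l] is [2 q] modulo [4 q], [G] is
    invariant under [2 q]; as [2 q] also changes its sign, it vanishes. *)
Lemma balanced_halve (f : int -> bool) (k l q : nat) :
    odd k -> odd l || (l %% 4 == 2)%N -> (0 < q)%N ->
    balanced f k l -> periodic f (4 * q) -> periodic f (2 * q).
Proof.
move=> k_odd l_mod q0 fb f4q.
(* [1 + 2 q] has the same effect on the steps, but it may be divisible by 3. *)
pose u := (1 + q * 6)%N.
have u6 : coprime u 6 by rewrite /u coprime_sym /coprime addnC gcdnMDl.
have fu := balanced_coprime6 u6 fb.
have shift (v : int) (m : nat) :
    odd m -> f (v + (m * (2 * q))%N) = f (v + (2 * q)%N).
  move=> m_odd.
  have -> : v + (m * (2 * q))%N = v + (2 * q)%N + (m./2 * (4 * q))%N by nia.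
  exact: periodic_mul.
have shift0 (v : int) (m : nat) : ~~ odd m -> f (v + (m * (2 * q))%N) = f v.
  move=> m_even.
  have -> : v + (m * (2 * q))%N = v + (m./2 * (4 * q))%N by nia.
  exact: periodic_mul.
have uk_add (v : int) : f (v + (u * k)%N) = f (v + (2 * q)%N + k).
  have -> : v + (u * k)%N = v + k + ((3 * k) * (2 * q))%N by rewrite /u; nia.
  by rewrite shift ?oddM // addrAC.
have uk_sub (v : int) : f (v - (u * k)%N%:Z) = f (v + (2 * q)%N - k%:Z).
  rewrite addrAC -(shift _ (3 * k)%N) ?oddM //.
  rewrite -(shift0 _ (3 * k).*2) ?odd_double //; congr f; rewrite /u; nia.
have [l_odd | l_even] := boolP (odd l).
  have ul_add (v : int) : f (v + (u * l)%N) = f (v + (2 * q)%N + l).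
    have -> : v + (u * l)%N = v + l + ((3 * l) * (2 * q))%N by rewrite /u; nia.
    by rewrite shift ?oddM // addrAC.
  have ul_sub (v : int) : f (v - (u * l)%N%:Z) = f (v + (2 * q)%N - l%:Z).
    rewrite addrAC -(shift _ (3 * l)%N) ?oddM //.
    rewrite -(shift0 _ (3 * l).*2) ?odd_double //; congr f; rewrite /u; nia.
  move=> v; have := fu v; rewrite uk_add uk_sub ul_add ul_sub.
  by rewrite fb => -[/double_inj]; do 2!case: (f _).
have ul_add (v : int) : f (v + (u * l)%N) = f (v + l).
  have -> : v + (u * l)%N = v + l + ((3 * l) * (2 * q))%N by rewrite /u; nia.
  by rewrite shift0 // oddM (negbTE l_even) andbF.
have ul_sub (v : int) : f (v - (u * l)%N%:Z) = f (v - l%:Z).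
  rewrite -(shift0 _ (3 * l)%N) ?oddM ?(negbTE l_even) ?andbF //.
  congr f; rewrite /u; nia.
pose G (v : int) : int := (f (v + (2 * q)%N) : nat)%:Z - (f v : nat)%:Z.
have GD (v : int) : G (v + l) + G (v - l%:Z) = 2 * G v.
  have := fu v; rewrite uk_add uk_sub ul_add ul_sub; have := fb (v + (2 * q)%N).
  rewrite /G (addrAC v l%:Z) (addrAC v (- l%:Z)).
  by do 8!move: (nat_of_bool (f _)) => ?; lia.
have Garith (v : int) (m : nat) :
    G (v + (m * l)%N) = G v + m%:Z * (G (v + l) - G v).
  elim/ltn_ind: m => -[|[|m]] IHm.
  - by rewrite !mul0n mul0r !addr0.
  - by rewrite mul1n mul1r addrCA subrr addr0.
  have := GD (v + (m.+1 * l)%N).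
  have -> : v + (m.+1 * l)%N + l = v + (m.+2 * l)%N by lia.
  have -> : v + (m.+1 * l)%N - l%:Z = v + (m * l)%N by lia.
  rewrite (IHm m) ?(IHm m.+1) //.
  by move: (G v) (G _ - G _) (G (_ + (m.+2 * l)%N%:Z)) => g D X; nia.
have G4q (v : int) (m : nat) : G (v + (m * (4 * q))%N) = G v.
  by rewrite /G (addrAC v) !(periodic_mul _ f4q).
have Gl (v : int) : G (v + l) = G v.
  (* After [4 q] steps [G] is back at [G v], so the difference is zero. *)
  have := Garith v (4 * q)%N; rewrite mulnC G4q; nia.
have Gl_mul (v : int) (m : nat) : G (v + (m * l)%N) = G v.
  by rewrite Garith Gl subrr mulr0 addr0.
have G2q (v : int) : G (v + (2 * q)%N) = - G v.
  rewrite /G; have -> : v + (2 * q)%N + (2 * q)%N = v + (4 * q)%N by lia.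
  by rewrite f4q opprB.
move=> v; suff : G v = 0 by rewrite /G; do 2!case: (f _).
have : G (v + (q * l)%N) = - G v.
  have -> : v + (q * l)%N = v + (2 * q)%N + (l %/ 4 * (4 * q))%N by nia.
  by rewrite G4q G2q.
by rewrite Gl_mul; lia.
Qed.

Lemma balanced_4dvd (f : int -> bool) (k l n : nat) :
    odd k || odd l -> (0 < n)%N -> balanced f k l -> periodic f n ->
  (4 %| n)%N.
Proof.
move=> kl n0 fb fn; apply: contraT => n4; exfalso.
have [n_odd|n_even] := boolP (odd n).
  apply: (@balanced_odd_period f k l n) => // v.
  by rewrite -muln2 mulnC periodic_mul.
by apply: (@balanced_odd_period f k l n./2) => //; [lia | rewrite even_halfK].
Qed.

Lemma balanced_aperiodic (f : int -> bool) (k l n : nat) :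
    odd k -> odd l || (l %% 4 == 2)%N -> (0 < n)%N ->
  balanced f k l -> ~ periodic f n.
Proof.
move=> k_odd l_mod n0 fb; elim/ltn_ind: n n0 => n IHn n0 fn.
have /dvdnP[q nE] : (4 %| n)%N.
  by apply: (balanced_4dvd _ n0 fb fn); rewrite k_odd.
apply: (IHn (2 * q)%N); [lia | lia |].
by apply: (balanced_halve k_odd l_mod _ fb); [lia | rewrite mulnC -nE].
Qed.

Local Close Scope ring_scope.

(** * Translation to circulant graphs *)

Lemma neighbour_count (gT : finGroupType) (x v : gT) (k l : nat)
    (C : {set gT}) :
    circ_quartic x k l ->
  #|[set w in C | cay (circ_set x k l) v w]| =
  ((v * x ^+ k)%g \in C) + ((v * x ^- k)%g \in C) +
  ((v * x ^+ l)%g \in C) + ((v * x ^- l)%g \in C).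
Proof.
case/andP=> x_uniq _.
rewrite cardsE -sum1_card (reindex_inj (mulgI v)) /=.
rewrite (eq_bigl (fun s => (s \in [:: x ^+ k; x ^- k; x ^+ l; x ^- l]%g) &&
                           ((v * s)%g \in C))); last first.
  by move=> s; rewrite unfold_in /cay mulKg !inE -!orbA andbC.
rewrite big_mkcondr -big_uniq //= !big_cons big_nil addn0 !addnA.
by do 4!case: (_ \in C).
Qed.

Lemma regular31_count (gT : finGroupType) (x : gT) (k l : nat) (C : {set gT}) :
    circ_quartic x k l ->
  (forall v, v \in C -> #|[set w in C | cay (circ_set x k l) v w]| = 3) /\
  (forall v, v \notin C -> #|[set w in C | cay (circ_set x k l) v w]| = 1) <->
  forall v, ((v * x ^+ k)%g \in C) + ((v * x ^- k)%g \in C) +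
            ((v * x ^+ l)%g \in C) + ((v * x ^- l)%g \in C) = (v \in C).*2.+1.
Proof.
move=> quartic; split=> [[inC outC] v | count].
  rewrite -neighbour_count //.
  by have [vC|vC] := boolP (v \in C); [rewrite inC | rewrite outC].
by split=> v vC; rewrite neighbour_count // count ?vC ?(negbTE vC).
Qed.

(** Integer powers; reduction modulo the order makes the exponent natural. *)
Definition zexpg (gT : finGroupType) (x : gT) (v : int) : gT :=
  (x ^+ `|(v %% #[x]%g)%Z|%N)%g.

Lemma zexpgD (gT : finGroupType) (x : gT) (v : int) (m : nat) :
  zexpg x (v + m)%R = (zexpg x v * x ^+ m)%g.
Proof.
have [a aE] : exists a : nat, (v %% #[x]%g)%Z = a.
  exists `|(v %% #[x]%g)%Z|%N.
  by rewrite gez0_abs // modz_ge0 // -lt0n order_gt0.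
by rewrite /zexpg -modzDml aE modz_nat !absz_nat expg_mod_order expgD.
Qed.

Lemma zexpgB (gT : finGroupType) (x : gT) (v : int) (m : nat) :
  zexpg x (v - m%:Z)%R = (zexpg x v * x ^- m)%g.
Proof. by rewrite -[v in RHS](subrK (Posz m)) zexpgD mulgK. Qed.

Lemma zexpg_periodic (gT : finGroupType) (x : gT) : periodic (zexpg x) #[x]%g.
Proof. by move=> v; rewrite zexpgD expg_order mulg1. Qed.

Lemma regular31_balanced (gT : finGroupType) (x : gT) (k l : nat)
    (C : {set gT}) :
    circ_quartic x k l -> regular_set (cay (circ_set x k l)) 3 1 C ->
  balanced (fun v => zexpg x v \in C) k l /\
  periodic (fun v => zexpg x v \in C) #[x]%g.
Proof.
move=> quartic [_ _ inC outC]; split=> v; last by rewrite zexpg_periodic.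
have /(regular31_count _ quartic) count := conj inC outC.
by rewrite !zexpgD !zexpgB count.
Qed.

(** * The regular set when 4 divides the order *)

Definition low_residues (gT : finGroupType) (x : gT) : {set gT} :=
  [set (x ^+ i)%g | i : 'I_#[x]%g & i %% 4 < 2].

Lemma mem_low_residues (gT : finGroupType) (x : gT) (j : nat) :
  4 %| #[x]%g -> ((x ^+ j)%g \in low_residues x) = (j %% 4 < 2).
Proof.
move=> x4; apply/imsetP/idP => [[i] | j4].
  rewrite inE => i4 /eqP; rewrite eq_expg_mod_order => /eqP ij.
  by rewrite -(modn_dvdm j x4) ij modn_dvdm.
have jx : j %% #[x]%g < #[x]%g by rewrite ltn_mod.
exists (Ordinal jx); rewrite ?inE /= ?modn_dvdm //.
by rewrite expg_mod_order.
Qed.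

Lemma low_residues_regular (gT : finGroupType) (x : gT) (k l : nat) :
    [set: gT] = <[x]>%g -> 4 %| #[x]%g -> circ_quartic x k l ->
    odd k && (4 %| l) || odd l && (4 %| k) ->
  regular_set (cay (circ_set x k l)) 3 1 (low_residues x).
Proof.
move=> gen_x x4 quartic kl.
have count : forall v,
  ((v * x ^+ k)%g \in low_residues x) + ((v * x ^- k)%g \in low_residues x) +
  ((v * x ^+ l)%g \in low_residues x) + ((v * x ^- l)%g \in low_residues x)
  = (v \in low_residues x).*2.+1.
  move=> v; have /cycleP[j ->] : v \in <[x]>%g by rewrite -gen_x inE.
  have xV m : (x ^- m = x ^+ (m * #[x].-1))%g.
    by rewrite -expgVn invg_expg -expgM mulnC.
  rewrite !xV -!expgD !mem_low_residues //.
  have low_odd a b : odd a -> 4 %| a + b ->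
      ((j + a) %% 4 < 2) + ((j + b) %% 4 < 2) = 1 by lia.
  have low4 a : 4 %| a -> ((j + a) %% 4 < 2) = (j %% 4 < 2) by lia.
  have x4V m : 4 %| m + m * #[x]%g.-1.
    by rewrite -mulnS prednK ?order_gt0 // dvdn_mull.
  have xV4 m : 4 %| m -> 4 %| m * #[x]%g.-1 by apply: dvdn_mulr.
  case/orP: kl => /andP[odd1 even1].
    by rewrite low_odd // !low4 ?xV4 //; case: (_ < 2).
  by rewrite (low4 k) // (low4 (k * _)) ?xV4 // -addnA low_odd //; case: (_ < 2).
have [inC outC] := (regular31_count _ quartic).2 count.
split=> //.
  by apply/set0Pn; exists (x ^+ 0)%g; rewrite mem_low_residues.
rewrite properE subsetT; apply/subsetPn.
by exists (x ^+ 2)%g; rewrite ?mem_low_residues ?inE.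
Qed.

(** * The three parity cases *)

Lemma no_regular31 (gT : finGroupType) (x : gT) (k l : nat) :
    odd k -> odd l || (l %% 4 == 2) -> circ_quartic x k l ->
  ~ (exists C : {set gT}, regular_set (cay (circ_set x k l)) 3 1 C).
Proof.
move=> k_odd l_mod quartic [C /(regular31_balanced quartic)[Cb Cp]].
exact: balanced_aperiodic k_odd l_mod (order_gt0 x) Cb Cp.
Qed.

Lemma circ_setC (gT : finGroupType) (x : gT) (k l : nat) :
  circ_set x k l = circ_set x l k.
Proof. by rewrite /circ_set -setUA setUC setUA. Qed.

Lemma circ_quarticC (gT : finGroupType) (x : gT) (k l : nat) :
  circ_quartic x k l = circ_quartic x l k.
Proof.
rewrite /circ_quartic (perm_uniq (permEl (perm_catC [:: x ^+ k; x ^- k]%g _))).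
by rewrite (perm_mem (permEl (perm_catC [:: x ^+ k; x ^- k]%g _))).
Qed.

Theorem theorem6p1p8 (n k l : nat) (gT : finGroupType) (x : gT)
    (n_gt0 : 0 < n) (k_gt0 : 0 < k) (l_gt0 : 0 < l)
    (gen_x : [set: gT] = <[x]>%g) (ord_x : #[x]%g = n)
    (quartic : circ_quartic x k l)
    (conn : connected_graph (cay (circ_set x k l))) :
  [/\ (odd k /\ l = 0 %[mod 4]) \/ (odd l /\ k = 0 %[mod 4]) ->
        ((exists C : {set gT}, regular_set (cay (circ_set x k l)) 3 1 C)
         <-> 4 %| n),
      (odd k /\ l = 2 %[mod 4]) \/ (odd l /\ k = 2 %[mod 4]) ->
        ~ (exists C : {set gT}, regular_set (cay (circ_set x k l)) 3 1 C)
    & k = 1 %[mod 2] /\ l = 1 %[mod 2] ->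
        ~ (exists C : {set gT}, regular_set (cay (circ_set x k l)) 3 1 C)].
Proof.
split=> [kl | [[k_odd l2] | [l_odd k2]] | [k_odd l_odd]].
- split=> [[C /(regular31_balanced quartic)[Cb Cp]] | n4].
    rewrite -ord_x; apply: (balanced_4dvd _ (order_gt0 x) Cb Cp).
    by case: kl => [[->]|[-> _]]; rewrite ?orbT.
  exists (low_residues x); apply: low_residues_regular; rewrite ?ord_x //.
  by rewrite /dvdn; case: kl => [[-> ->]|[-> ->]]; rewrite ?orbT.
- by apply: no_regular31 => //; rewrite l2 orbT.
- by rewrite circ_setC; apply: no_regular31; rewrite ?k2 ?orbT // circ_quarticC.
by apply: no_regular31 => //; lia.
Qed.
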